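(* Let $d\ge 2$ and let $(c_\lambda)_{\lambda\vdash 2d}$ be real numbers; write $f^{(n)}=\sum_{\lambda\vdash 2d}c_\lambda p^{(n)}_\lambda$. Then $f^{(n)}$ is nonnegative on $\mathbb{R}^n$ for every $n\ge 2d$ if and only if the $2d$-variate polynomial $\Phi_f(s,t)=\sum_{\lambda\vdash 2d}c_\lambda\Phi_\lambda(s,t)$ is nonnegative on $\Delta\times\mathbb{R}^d$.
   Context: $p_i^{(n)}=\frac1n(x_1^i+\dots+x_n^i)$ and $p^{(n)}_\lambda=\prod_{i=1}^l p^{(n)}_{\lambda_i}$ for a partition $\lambda=(\lambda_1,\dots,\lambda_l)$ of $2d$. For such $\lambda$, $\Phi_\lambda(s_1,\dots,s_d,t_1,\dots,t_d)=\prod_{i=1}^l\left(s_1t_1^{\lambda_i}+\dots+s_dt_d^{\lambda_i}\right)$. $\Delta=\{\alpha\in[0,1]^d:\alpha_1+\dots+\alpha_d=1\}$ is the standard simplex. *)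

(* Defs.v *)
From mathcomp Require Import all_boot all_order all_algebra.
From mathcomp Require Import reals.
Set Implicit Arguments. Unset Strict Implicit. Unset Printing Implicit Defensive.
Import Order.TTheory GRing.Theory Num.Theory.
Local Open Scope ring_scope.

(* Integer partitions, represented as nonincreasing sequences of positive parts. *)
(* partsb fuel n m = list of all partitions of n with all parts <= m,
   each exactly once, largest part first. *)
Fixpoint partsb (fuel n m : nat) : seq (seq nat) :=
  match fuel with
  | 0 => if n == 0%N then [:: [::]] else [::]
  | fuel'.+1 =>
      if n == 0%N then [:: [::]]
      else flatten [seq [seq k :: l | l <- partsb fuel' (n - k) k]
                   | k <- iota 1 (minn n m)]
  end.

Definition partitions (n : nat) : seq (seq nat) := partsb n n n.

Definition psum {R : realType} (n i : nat) (x : 'I_n -> R) : R :=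
  n%:R^-1 * \sum_(j < n) x j ^+ i.

Definition plam {R : realType} (n : nat) (lam : seq nat) (x : 'I_n -> R) : R :=
  \prod_(i <- lam) psum i x.

Definition fpoly {R : realType} (d : nat) (c : seq nat -> R) (n : nat)
    (x : 'I_n -> R) : R :=
  \sum_(lam <- partitions (2 * d)) c lam * plam lam x.

Definition Phi_lam {R : realType} (d : nat) (lam : seq nat)
    (s t : 'I_d -> R) : R :=
  \prod_(i <- lam) \sum_(j < d) s j * t j ^+ i.

Definition Phi_f {R : realType} (d : nat) (c : seq nat -> R)
    (s t : 'I_d -> R) : R :=
  \sum_(lam <- partitions (2 * d)) c lam * Phi_lam lam s t.

Definition in_simplex {R : realType} (d : nat) (s : 'I_d -> R) : Prop :=
  (forall j, 0 <= s j <= 1) /\ \sum_(j < d) s j = 1.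

(* Main.v *)
Require Import Defs.
From mathcomp Require Import all_boot all_order all_algebra.
From mathcomp Require Import reals.
From mathcomp Require Import qpoly polyrcf zify ring lra.
From mathcomp Require Import classical_sets topology normedtype sequences.
Set Implicit Arguments.
Unset Strict Implicit.
Unset Printing Implicit Defensive.
Import Order.TTheory GRing.Theory Num.Theory.
Import numFieldNormedType.Exports.
Local Open Scope ring_scope.

(** Both sides evaluate one form, f(m_1, ..., m_2d), at the moments of a finitely
    supported probability measure: the uniform measure on n points for f^(n), and a
    measure with d weighted atoms for Phi_f.

    If Phi_f >= 0, let mu be uniform on x_1, ..., x_n, and let nu be its d-node Gauss
    quadrature. Then mu and nu have the same moments below 2d, and
    m_2d(nu) <= m_2d(mu) because the square of the monic orthogonal polynomial of
    degree d has integral 0 against nu. For degree reasons m_2d occurs in f only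
    through the term c_(2d) m_2d, so f(mu) - f(nu) = c_(2d) (m_2d(mu) - m_2d(nu)).
    Finally c_(2d) >= 0: giving an atom at 1/e the mass e^(2d), and the rest of the mass
    to an atom at 0, makes all moments below 2d tend to 0 while m_2d = 1.

    Conversely, measures whose weights are multiples of some 1/N are uniform on N
    points counted with repetition, and they approximate every weight vector. *)

(** * Sign changes of polynomials, and sequences of nodes *)

(* The zs are the roots at which p changes sign. *)
Lemma exists_prod_roots_constant_sign (R : rcfType) (p : {poly R}) : p != 0 ->
  exists zs : seq R, exists2 a : R, a != 0 &
    [/\ uniq zs, all (root p) zs &
      forall y, 0 <= a * (\prod_(z <- zs) ('X - z%:P) * p).[y]].
Proof.
have [n] := ubnP (size p); elim: n p => // n IHn p szp p0.
case: (boolP (has (root p) (rootsR p))) => [/hasP[z _ pz]|noroot].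
  have /factor_theorem[q pE] := pz.
  have q0 : q != 0 by apply: contra_neq p0 => q0; rewrite pE q0 mul0r.
  have szq : (size q < n)%N.
    by move: szp; rewrite pE size_Mmonic ?monicXsubC // size_XsubC addn2.
  have [zs [a a0 [uzs rzs sgn]]] := IHn q szq q0.
  have rpzs : all (root p) zs.
    by apply: sub_all rzs => y qy; rewrite pE rootM qy.
  (* If [z] is already listed for [q], dropping it hands its factor over to [p] and leaves the
     product unchanged; otherwise adding it creates the square of ['X - z%:P]. *)
  have [zzs|zzs] := boolP (z \in zs).
    exists (rem z zs); exists a => //; split; first exact: rem_uniq.
      by apply/allP => y /mem_rem /(allP rpzs).
    move=> y; have := sgn y; rewrite (perm_big _ (perm_to_rem zzs)) big_cons pE.
    by set S := \prod_(_ <- _) _; have -> : S * (q * ('X - z%:P)) = ('X - z%:P) * S * q by ring.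
  exists (z :: zs); exists a => //; split; rewrite /= ?zzs ?pz //.
  move=> y; rewrite big_cons pE.
  have -> : a * (('X - z%:P) * (\prod_(z <- zs) ('X - z%:P)) *
      (q * ('X - z%:P))).[y] =
    (y - z) ^+ 2 * (a * (\prod_(z <- zs) ('X - z%:P) * q).[y]).
    by rewrite !hornerM hornerXsubC; ring.
  by rewrite mulr_ge0 // sqr_ge0.
have {}noroot x : ~~ root p x.
  apply: contra noroot => px; apply/hasP; exists x => //.
  by rewrite -(roots_on_rootsR p0).
(* Without roots, [p] keeps the sign of [p.[0]] by the intermediate value theorem. *)
exists [::], p.[0]; [exact: noroot|split => // y].
rewrite big_nil mul1r leNgt; apply/negP => neg.
have [y0|/ltW y0] := leP 0 y.
  by have [x _] := poly_ivtoo y0 neg; apply/negP.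
by rewrite mulrC in neg; have [x _] := poly_ivtoo y0 neg; apply/negP.
Qed.

(** [lagrange] takes its nodes from an injective sequence on all of [nat], so a list is continued by
    the values [M + i%:R], where [M] exceeds every entry. *)
Lemma uniq_extend_injective (R : realDomainType) (zs : seq R) : uniq zs ->
  exists2 z : nat -> R, injective z & forall i, (i < size zs)%N -> z i = zs`_i.
Proof.
move=> uzs; pose M : R := \sum_(y <- zs) `|y| + 1.
have zsM i : (i < size zs)%N -> zs`_i < M.
  move=> /(mem_nth 0) zi; rewrite /M (big_rem _ zi) /=.
  rewrite ltr_pwDr // (le_trans (ler_norm _)) // lerDl sumr_ge0 // => y _.
have ltM i j : (i < size zs)%N -> zs`_i != M + j%:R.
  by move=> /zsM iM; rewrite lt_eqF // (lt_le_trans iM) // lerDl.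
exists (fun i => if (i < size zs)%N then zs`_i else M + i%:R) => [i j|i -> //].
case: ifP => iz; case: ifP => jz.
- by move/eqP; rewrite nth_uniq // => /eqP.
- by move/eqP; rewrite (negPf (ltM _ _ iz)).
- by move/eqP; rewrite eq_sym (negPf (ltM _ _ jz)).
- by move/addrI/eqP; rewrite eqr_nat => /eqP.
Qed.

(** * Gauss quadrature for a finitely supported measure *)

Section Quadrature.
Context {R : rcfType} {I : finType} (m x : I -> R).
Hypothesis m_gt0 : forall i, 0 < m i.

Let E (g : {poly R}) : R := \sum_i m i * g.[x i].

Let E_sum J (r : seq J) (F : J -> {poly R}) :
  E (\sum_(j <- r) F j) = \sum_(j <- r) E (F j).
Proof.
rewrite /E exchange_big /=; apply: eq_bigr => i _.
by rewrite horner_sum mulr_sumr.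
Qed.

Let E_Z a (g : {poly R}) : E (a *: g) = a * E g.
Proof.
rewrite /E mulr_sumr; apply: eq_bigr => i _.
by rewrite hornerZ mulrCA.
Qed.

Let E_D (f g : {poly R}) : E (f + g) = E f + E g.
Proof.
rewrite /E -big_split; apply: eq_bigr => i _.
by rewrite hornerD mulrDr.
Qed.

(** The [d.+1] coefficients of [p] are subject to [d] linear conditions, one for each ['X^j] with
    [j < d], so the moment matrix [A] has a nonzero left kernel. *)
Lemma exists_orthogonal_poly d : exists2 p : {poly R}, p != 0 /\ (size p <= d.+1)%N &
  forall h : {poly R}, (size h <= d)%N -> \sum_i m i * (p * h).[x i] = 0.
Proof.
pose A : 'M[R]_(d.+1, d) := \matrix_(i, j) E 'X^(i + j).
have /rowV0Pn[v /sub_kermxP vA v0] : kermx A != 0.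
  by rewrite -mxrank_eq0 mxrank_ker -lt0n subn_gt0 ltnS rank_leq_col.
have [k vk] : exists k, v 0 k != 0 by apply/rV0Pn.
pose p := \sum_(i < d.+1) v 0 i *: 'X^i : {poly R}.
have pE : p = \poly_(i < d.+1) v 0 (inord i).
  by rewrite poly_def; apply: eq_bigr => i _; rewrite inord_val.
exists p; first split.
- apply: contra_neq vk => /(congr1 (fun q : {poly R} => q`_k)).
  by rewrite pE coef_poly ltn_ord inord_val coef0.
- by rewrite pE size_poly.
move=> h szh; rewrite -[LHS]/(E _).
have -> : h = \sum_(j < d) h`_j *: 'X^j.
  rewrite -poly_def; apply/polyP => j; rewrite coef_poly; case: ltnP => // dj.
  by rewrite nth_default // (leq_trans szh).
rewrite mulr_sumr E_sum big1 // => j _; rewrite -scalerAr E_Z.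
rewrite mulr_suml E_sum.
have := congr1 (fun B : 'rV_d => B 0 j) vA; rewrite !mxE => vAj.
rewrite (_ : \sum_(_ <- _) _ = 0) ?mulr0 // -[RHS]vAj; apply: eq_bigr => i _.
by rewrite -scalerAl -exprD E_Z !mxE.
Qed.

(** Either the orthogonal polynomial vanishes on the support, which then has at most [d] points and
    can be put among the nodes, or it has [d] distinct roots in [R], which are the nodes. *)
Lemma exists_orthogonal_prod_XsubC d : exists2 z : nat -> R, injective z &
  forall h : {poly R}, (size h <= d)%N ->
    \sum_i m i * (\prod_(j < d) ('X - (z j)%:P) * h).[x i] = 0.
Proof.
have [p [p0 szp] orth] := exists_orthogonal_poly d.
have [pvan|/forallPn[i0 pi0]] := boolP [forall i, root p (x i)].
  have usz : (size (undup (codom x)) <= d)%N.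
    rewrite -ltnS (leq_trans _ szp) // max_poly_roots ?undup_uniq //.
    by apply/allP => y; rewrite mem_undup => /codomP[i ->]; apply: (forallP pvan).
  have [z zinj zE] := uniq_extend_injective (undup_uniq (codom x)).
  exists z => // h _; apply: big1 => i _.
  have : x i \in undup (codom x) by rewrite mem_undup codom_f.
  move=> /[dup] xi; rewrite -index_mem => ilt.
  rewrite hornerM horner_prod (bigD1 (Ordinal (leq_trans ilt usz))) //=.
  by rewrite zE // nth_index // hornerXsubC subrr !mul0r mulr0.
have [zs [a a0 [uzs rzs sgn]]] := exists_prod_roots_constant_sign p0.
have szzs : size zs = d.
  apply/eqP; rewrite eqn_leq -ltnS (leq_trans (max_poly_roots p0 rzs uzs)) //=.
  (* With fewer than [d] sign changes, the product over [zs] is orthogonal to [p]; yet its product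
     with [a] and [p] is nonnegative, and nonzero at [x i0]. *)
  rewrite leqNgt; apply/negP => zsd.
  have := orth (\prod_(z <- zs) ('X - z%:P)).
  rewrite size_prod_XsubC => /(_ zsd) /(congr1 ( *%R a)) /eqP.
  rewrite mulr0 mulr_sumr psumr_eq0 => [|i _]; last first.
    by rewrite mulrCA mulr_ge0 ?(ltW (m_gt0 i)) // [p * _]mulrC sgn.
  move=> /allP /(_ i0 (mem_index_enum _)) /=.
  rewrite !mulf_eq0 (negPf a0) gt_eqF //= -rootE rootM.
  rewrite (negPf pi0) root_prod_XsubC => /(allP rzs).
  exact/negP.
have [z zinj zE] := uniq_extend_injective uzs; exists z => // h szh.
have -> : \prod_(j < d) ('X - (z j)%:P) = \prod_(y <- zs) ('X - y%:P).
  rewrite (big_nth 0) szzs big_mkord; apply: eq_bigr => j _.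
  by rewrite zE // szzs.
have pE : p = lead_coef p *: \prod_(y <- zs) ('X - y%:P).
  apply: all_roots_prod_XsubC; rewrite ?uniq_rootsE //.
  apply/eqP; rewrite eqn_leq (max_poly_roots p0 rzs uzs) andbT szzs //.
have /eqP := orth h szh; rewrite {1}pE -/(E _) -scalerAl E_Z mulf_eq0.
by rewrite lead_coef_eq0 (negPf p0) => /eqP.
Qed.

Lemma gauss_quadrature d : (0 < d)%N -> exists w z : 'I_d -> R,
  [/\ forall j, 0 <= w j,
      forall g : {poly R}, (size g <= d.*2)%N ->
        \sum_i m i * g.[x i] = \sum_j w j * g.[z j] &
      \sum_j w j * z j ^+ d.*2 <= \sum_i m i * x i ^+ d.*2].
Proof.
move=> d0; have [z zinj orth] := exists_orthogonal_prod_XsubC d.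
set S := \prod_(j < d) _ in orth.
have Smon : S \is monic by apply: monic_prod_XsubC.
have szS : size S = d.+1 by rewrite size_prod_XsubC /index_enum -enumT size_enum_ord.
have Sz (j : 'I_d) : S.[z j] = 0.
  by rewrite horner_prod (bigD1 j) //= hornerXsubC subrr mul0r.
pose L j := tnth (lagrange d z) j : {poly R}.
have quad (g : {poly R}) : (size g <= d.*2)%N -> E g = \sum_j E (L j) * g.[z j].
  move=> szg; rewrite {1}(divp_eq g S) E_D [_ %/ _ * _]mulrC.
  rewrite [E (S * _)]orth ?add0r; last first.
    by rewrite size_divp ?monic_neq0 // szS leq_subLR addnn.
  have szr : (size (g %% S)%R <= d)%N by rewrite -ltnS -szS ltn_modp monic_neq0.
  rewrite {1}(lagrange_gen d0 zinj szr) E_sum; apply: eq_bigr => j _.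
  rewrite mul_polyC E_Z mulrC; congr (_ * _).
  by rewrite {2}(divp_eq g S) hornerD hornerM Sz mulr0 add0r.
have szL j : size (L j) = d by apply: size_lagrange_.
have Lz (j k : 'I_d) : (L j).[z k] = (j == k)%:R by apply: lagrange_sample.
exists (fun j => E (L j)), z; split => //.
  move=> j; have -> : E (L j) = E (L j ^+ 2).
    rewrite [RHS]quad ?(leq_trans (size_poly_exp_leq _ _)) //; last first.
      by rewrite szL; lia.
    rewrite (bigD1 j) //= big1 => [|k kj].
      by rewrite horner_exp Lz eqxx expr1n mulr1 addr0.
    by rewrite horner_exp Lz eq_sym (negPf kj) expr0n mulr0.
  by apply: sumr_ge0 => i _; rewrite mulr_ge0 ?(ltW (m_gt0 i)) // horner_exp sqr_ge0.
pose T := S ^+ 2 - 'X^(d.*2).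
have szT : (size T <= d.*2)%N.
  have szS2 : size (S ^+ 2) = d.*2.+1.
    by rewrite expr2 size_Mmonic ?monic_neq0 // szS addnS /= -addnn.
  apply/leq_sizeP => k; rewrite leq_eqVlt coefB coefXn => /predU1P[<-|dk].
    have /monicP := monic_exp 2 Smon; rewrite lead_coefE szS2 /= => ->.
    by rewrite eqxx subrr.
  by rewrite gtn_eqF // subr0 nth_default // szS2.
have TE : S ^+ 2 = T + 'X^(d.*2) by rewrite subrK.
have : 0 <= E (S ^+ 2).
  by apply: sumr_ge0 => i _; rewrite mulr_ge0 ?(ltW (m_gt0 i)) // horner_exp sqr_ge0.
rewrite TE E_D quad //.
have -> : \sum_j E (L j) * T.[z j] = - \sum_j E (L j) * z j ^+ d.*2.
  rewrite -sumrN; apply: eq_bigr => j _.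
  by rewrite hornerD hornerN hornerXn horner_exp Sz expr0n sub0r mulrN.
rewrite addrC subr_ge0 => /le_trans; apply.
by rewrite le_eqVlt; apply/orP; left; apply/eqP/eq_bigr => i _; rewrite hornerXn.
Qed.
End Quadrature.

Lemma partsbP fuel n k lam : lam \in partsb fuel n k ->
  sumn lam = n /\ all (leq 1) lam.
Proof.
elim: fuel n k lam => [|fuel IH] n k lam /=; case: eqP => [->|n0] //;
  do ?by rewrite inE => /eqP ->.
move=> /flattenP[s /mapP[i]]; rewrite mem_iota => iP -> /mapP[l lP ->] /=.
by have [-> ->] := IH _ _ _ lP; rewrite andbT; lia.
Qed.

Lemma partitions_parts n lam : lam \in partitions n -> lam != [:: n] ->
  forall i, i \in lam -> (0 < i < n)%N.
Proof.
move=> /partsbP[sl pos] ln i il; rewrite (allP pos _ il) /= ltn_neqAle.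
have pl := perm_to_rem il; have := perm_sumn pl; rewrite sl /= => nE.
rewrite {2}nE leq_addr andbT; apply: contra ln => /eqP iE.
have rem0 : sumn (rem i lam) = 0%N by lia.
have remnil : rem i lam = [::].
  case E : (rem i lam) => [//|y s]; have y1 : (0 < y)%N.
    by apply: (allP pos); apply: (@mem_rem _ i); rewrite E mem_head.
  by move: rem0; rewrite E /=; lia.
have := perm_size pl; rewrite remnil; case: lam il {pl sl pos nE rem0 remnil} => [//|y [|//]].
by rewrite inE iE => /eqP ->.
Qed.

Definition mform {R : realType} (n : nat) (c : seq nat -> R) (M : nat -> R) : R :=
  \sum_(lam <- partitions n) c lam * \prod_(i <- lam) M i.

(* Equals [c [:: n]]; as a sum over the enumeration it needs no proof that [:: n]
   is listed exactly once. *)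
Definition mform_lead {R : realType} (n : nat) (c : seq nat -> R) : R :=
  \sum_(lam <- partitions n | lam == [:: n]) c lam.

Lemma mformE {R : realType} n (c : seq nat -> R) M :
  mform n c M = mform_lead n c * M n +
    \sum_(lam <- partitions n | lam != [:: n]) c lam * \prod_(i <- lam) M i.
Proof.
rewrite /mform (bigID (fun lam => lam == [:: n])) /= mulr_suml; congr (_ + _).
by apply: eq_bigr => lam /eqP ->; rewrite big_seq1.
Qed.

Lemma mform_eq_lower {R : realType} n (c : seq nat -> R) M N :
  (forall i, (0 < i < n)%N -> M i = N i) ->
  mform n c M = mform n c N + mform_lead n c * (M n - N n).
Proof.
move=> MN; rewrite !mformE; set s := \sum_(_ <- _ | _) _; set t := \sum_(_ <- _ | _) _.
suff -> : s = t by ring.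
rewrite /s /t big_seq_cond [RHS]big_seq_cond; apply: eq_bigr => lam /andP[lp ln].
congr (_ * _); rewrite big_seq [RHS]big_seq; apply: eq_bigr => i il.
by rewrite MN // (partitions_parts lp ln).
Qed.

Lemma mform_lead_ge0 {R : realType} n (c : seq nat -> R) : (0 < n)%N ->
  (forall e : R, 0 < e <= 1 -> 0 <= mform n c (fun i => e ^+ (n - i))) ->
  0 <= mform_lead n c.
Proof.
move=> n0 pos; rewrite leNgt; apply/negP => neg.
pose a := - mform_lead n c; pose C := \sum_(lam <- partitions n) `|c lam|.
have a0 : 0 < a by rewrite oppr_gt0.
have C0 : 0 <= C by apply: sumr_ge0.
pose e := a / (a + C + 1).
have e0 : 0 < e by rewrite divr_gt0 //; lra.
have e1 : e <= 1 by rewrite ler_pdivrMr; lra.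
have : e * C < a by rewrite /e mulrAC ltr_pdivrMr; [nra|lra].
apply/negP; rewrite -leNgt.
have := pos e; rewrite e0 e1 => /(_ isT); rewrite mformE subnn expr0 mulr1.
suff : \sum_(lam <- partitions n | lam != [:: n]) c lam *
  \prod_(i <- lam) e ^+ (n - i) <= e * C by rewrite /a; lra.
rewrite /C mulr_sumr [leRHS](bigID (fun lam => lam != [:: n])) /=.
rewrite -[leLHS]addr0 lerD //; last first.
  by apply: sumr_ge0 => lam _; rewrite mulr_ge0 // ltW.
rewrite big_seq_cond [leRHS]big_seq_cond; apply: ler_sum => lam /andP[lp ln].
have p0 s : 0 <= \prod_(i <- s) e ^+ (n - i).
  by apply: prodr_ge0 => i _; rewrite exprn_ge0 // ltW.
apply: (le_trans (ler_norm _)); rewrite normrM (ger0_norm (p0 _)) mulrC.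
rewrite ler_wpM2r //; have parts := partitions_parts lp ln.
case: lam lp {ln} parts => [|i s] lp parts.
  by have [/= sn _] := partsbP lp; rewrite -sn in n0.
have /andP[_ i_n] := parts i (mem_head _ _).
have e0' := ltW e0.
rewrite big_cons -[leRHS]mulr1 ler_pM ?exprn_ge0 //.
  by rewrite -[leRHS]expr1 ler_wiXn2l // subn_gt0.
by apply: prodr_ile1 => k _; rewrite exprn_ge0 ?exprn_ile1.
Qed.

Lemma fpolyE {R : realType} d (c : seq nat -> R) n (x : 'I_n -> R) :
  fpoly d c x = mform (2 * d) c (fun i => psum i x).
Proof. by []. Qed.

Lemma Phi_fE {R : realType} d (c : seq nat -> R) (s t : 'I_d -> R) :
  Phi_f c s t = mform (2 * d) c (fun i => \sum_(j < d) s j * t j ^+ i).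
Proof. by []. Qed.

Lemma Phi_f_lead_ge0 {R : realType} d (c : seq nat -> R) : (2 <= d)%N ->
  (forall s t : 'I_d -> R, in_simplex s -> 0 <= Phi_f c s t) ->
  0 <= mform_lead (2 * d) c.
Proof.
move=> d2 pos; apply: mform_lead_ge0 => [|e /andP[e0 e1]]; first by lia.
pose j0 : 'I_d := Ordinal (ltnW d2); pose j1 : 'I_d := Ordinal d2.
have j10 : j1 != j0 by [].
pose w := e ^+ (2 * d).
have w01 : 0 <= w <= 1 by rewrite exprn_ge0 ?exprn_ile1 // ltW.
have simplex_sum (F : 'I_d -> R) : (forall j, j != j0 -> j != j1 -> F j = 0) ->
    \sum_(j < d) F j = F j0 + F j1.
  move=> F0; rewrite (bigD1 j0) //= (bigD1 j1) //= big1 ?addr0 // => j /andP[*].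
  exact: F0.
pose s j : R := if j == j0 then 1 - w else if j == j1 then w else 0.
pose t j : R := if j == j1 then e^-1 else 0.
have ss : in_simplex s.
  split=> [j|]; last by rewrite simplex_sum /s ?eqxx ?(negPf j10) ?subrK // => j /negPf-> /negPf->.
  by rewrite /s; case: ifP => _; [lra|case: ifP => _; lra].
have := pos s t ss; rewrite Phi_fE; congr (0 <= _).
apply: eq_big_seq => lam /partsbP[lsum lpos]; congr (_ * _); apply: eq_big_seq => i il.
have i0 := allP lpos _ il.
rewrite simplex_sum => [|j /negPf j_0 /negPf j_1]; last by rewrite /s j_0 j_1 mul0r.
rewrite /s /t eqxx (negPf j10) eqxx eq_sym (negPf j10) expr0n gtn_eqF // mulr0 add0r.
have ile : (i <= 2 * d)%N.
  by have := perm_sumn (perm_to_rem il); rewrite lsum /= => ->; apply: leq_addr.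
by rewrite /w -[in LHS](subnK ile) exprD exprVn mulfK // expf_neq0 // gt_eqF.
Qed.

Lemma fpoly_ge0_of_Phi {R : realType} d (c : seq nat -> R) : (2 <= d)%N ->
  (forall s t : 'I_d -> R, in_simplex s -> 0 <= Phi_f c s t) ->
  forall n (x : 'I_n -> R), (0 < n)%N -> 0 <= fpoly d c x.
Proof.
move=> d2 pos n x n0.
have n_gt0 : forall i : 'I_n, 0 < n%:R^-1 :> R by move=> i; rewrite invr_gt0 ltr0n.
have [w [z [w0 quad top]]] := gauss_quadrature x n_gt0 (ltnW d2).
have psumE i : psum i x = \sum_j n%:R^-1 * x j ^+ i by rewrite /psum mulr_sumr.
have w1 : \sum_j w j = 1.
  have d_gt0 : (size (1%:P : {poly R}) <= d.*2)%N by rewrite size_poly1; lia.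
  have := quad _ d_gt0.
  under eq_bigr do rewrite hornerC mulr1.
  under [X in _ = X]eq_bigr do rewrite hornerC mulr1.
  by rewrite sumr_const card_ord -(mulr_natr _^-1) mulVf ?pnatr_eq0 -?lt0n.
have sw : in_simplex w.
  split=> // j; rewrite w0 -w1 (bigD1 j) //= lerDl; exact: sumr_ge0.
rewrite fpolyE (@mform_eq_lower _ _ _ _ (fun i => \sum_j w j * z j ^+ i)).
  rewrite addr_ge0 //; first by rewrite -Phi_fE pos.
  by rewrite mulr_ge0 ?Phi_f_lead_ge0 // subr_ge0 psumE mul2n.
move=> i /andP[_ id]; rewrite psumE; have := quad 'X^i.
rewrite size_polyXn -mul2n => /(_ id).
by under eq_bigr do rewrite hornerXn; under [X in _ = X]eq_bigr do rewrite hornerXn.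
Qed.

Lemma Phi_f_natural_weights {R : realType} d (c : seq nat -> R) (k : 'I_d -> nat)
    (t : 'I_d -> R) :
  exists x : 'I_(\sum_j k j) -> R, fpoly d c x =
    Phi_f c (fun j => (k j)%:R / (\sum_j k j)%:R) t.
Proof.
pose xs := flatten [seq nseq (k j) (t j) | j <- enum 'I_d].
have szxs : (\sum_j k j)%N = size xs.
  rewrite size_flatten /shape -map_comp sumnE big_map big_enum /=.
  by apply: eq_bigr => j _; rewrite size_nseq.
exists (fun i => xs`_i); rewrite fpolyE Phi_fE; apply: eq_bigr => lam _.
congr (_ * _); apply: eq_bigr => i _.
rewrite /psum; under [RHS]eq_bigr do rewrite mulrAC -mulrC.
rewrite -mulr_sumr; congr (_ * _).
rewrite szxs -(big_mkord xpredT (fun j => xs`_j ^+ i)) -(big_nth 0 xpredT (fun y => y ^+ i)).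
rewrite big_flatten big_map big_enum /=; apply: eq_bigr => j _.
by rewrite big_nseq iter_addr_0 mulr_natl.
Qed.

Lemma Phi_f_cvg {R : realType} d (c : seq nat -> R) (s_ : nat -> 'I_d -> R)
    (s t : 'I_d -> R) :
  (forall j, s_ n j @[n --> \oo] --> s j)%classic ->
  (Phi_f c (s_ n) t @[n --> \oo] --> Phi_f c s t)%classic.
Proof.
move=> cvs; rewrite /Phi_f /Phi_lam.
apply: cvg_big => [|lam _]; first exact: add_continuous.
apply: cvgMr; apply: cvg_big => [|i _]; first exact: mul_continuous.
apply: cvg_big => [|j _]; first exact: add_continuous.
exact: cvgMl.
Qed.

Lemma cvg_truncn_ratio {R : realType} (a : R) : 0 <= a ->
  ((Num.truncn (n.+1%:R * a)).+1%:R / n.+1%:R @[n --> \oo] --> a)%classic.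
Proof.
move=> a0.
apply: (@squeeze_cvgr _ _ _ _ (fun=> a) (fun n => a + n.+1%:R^-1)).
- near=> n; have n0 : 0 < n.+1%:R :> R by rewrite ltr0n.
  have /andP[lo hi] := truncn_itv (mulr_ge0 (ltW n0) a0).
  rewrite ler_pdivlMr // [a * _]mulrC (ltW hi) ler_pdivrMr // mulrDl mulVf ?gt_eqF //.
  by rewrite -(natr1 (Num.truncn _)) lerD2r [a * _]mulrC.
- exact: cvg_cst.
- rewrite -[X in (_ --> X)%classic]addr0; apply: cvgD; first exact: cvg_cst.
  exact: cvg_harmonic.
Unshelve. all: by end_near.
Qed.

Lemma Phi_f_ge0_of_fpoly {R : realType} d (c : seq nat -> R) n0 :
  (forall n, (n0 <= n)%N -> forall x : 'I_n -> R, 0 <= fpoly d c x) ->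
  forall s t : 'I_d -> R, in_simplex s -> 0 <= Phi_f c s t.
Proof.
move=> pos s t [s01 s1].
have s0 j : 0 <= s j by case/andP: (s01 j).
pose k n j := (Num.truncn (n.+1%:R * s j)).+1.
pose u n j : R := (k n j)%:R / n.+1%:R.
have cvu j : (u n j @[n --> \oo] --> s j)%classic by apply: cvg_truncn_ratio.
have cvU : (\sum_j u n j @[n --> \oo] --> (1 : R))%classic.
  by rewrite -s1; apply: cvg_big => [|j _]; [exact: add_continuous|exact: cvu].
have cvs j : (u n j / \sum_j u n j @[n --> \oo] --> s j)%classic.
  rewrite -[X in (_ --> X)%classic]divr1; apply: cvgM; first exact: cvu.
  by apply: cvgV => //; exact: oner_neq0.
have := @Phi_f_cvg R d c (fun n j => u n j / \sum_j u n j) s t cvs.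
move=> /cvgr_to_ge; apply.
near=> n.
have kn : (n <= \sum_j k n j)%N.
  rewrite -(ler_nat R) natr_sum.
  have -> : n%:R = \sum_j n%:R * s j :> R by rewrite -mulr_sumr s1 mulr1.
  apply: ler_sum => j _.
  have /andP[_ /ltW] := truncn_itv (mulr_ge0 (ler0n R n.+1) (s0 j)).
  by apply: le_trans; rewrite ler_wpM2r // ler_nat.
have [x xE] := Phi_f_natural_weights c (k n) t.
have <- : fpoly d c x = Phi_f c (fun j => u n j / \sum_j u n j) t.
  rewrite xE /Phi_f; apply: eq_bigr => lam _; congr (_ * _).
  apply: eq_bigr => i _; apply: eq_bigr => j _; congr (_ * _).
  by rewrite /u -mulr_suml invfM invrK mulrACA mulVf ?pnatr_eq0 // mulr1 natr_sum.
apply: pos; apply: leq_trans kn.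
by near: n; exact: nbhs_infty_ge.
Unshelve. all: by end_near.
Qed.

Theorem theorem3p4 (R : realType) (d : nat) (hd : (2 <= d)%N)
    (c : seq nat -> R) :
  (forall n : nat, (2 * d <= n)%N -> forall x : 'I_n -> R, 0 <= fpoly d c x)
  <->
  (forall s t : 'I_d -> R, in_simplex s -> 0 <= Phi_f c s t).
Proof.
split; first exact: Phi_f_ge0_of_fpoly.
move=> pos n dn x; apply: fpoly_ge0_of_Phi => //.
by apply: leq_trans dn; rewrite muln_gt0 (ltnW hd).
Qed.
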